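(* Let $\{x^k\}_{k=0}^\infty$ be the (infinite) sequence generated by the algorithm cDCA described in the context (with $x^{-1}$ the additional starting point), with parameters $\lambda>0$, $\delta\in(0,\frac{2\lambda}{L_f})$, $\mu=\frac{2}{2\lambda+L_f}$. Set $\tau=\frac{(1-\mu\lambda)^2\delta^2}{2\lambda\mu^2}$ (so that $\tau=\frac{L_f^2\delta^2}{8\lambda}<\frac{\lambda}{2}$) and $$E(x,y)=F(x)+\tau\|x-y\|^2,\qquad (x,y)\in\mathbb{R}^n\times\mathbb{R}^n.$$ Then the following statements hold: (i) The sequence $\{E(x^k,x^{k-1})\}_{k=0}^\infty$ is nonincreasing and satisfies $$E(x^{k+1},x^k)+\Big(\frac{\lambda}{2}-\tau\Big)\|x^k-x^{k+1}\|^2\le E(x^k,x^{k-1}),\qquad \forall k\ge 0.$$ (ii) $\omega(x^k)\subset\mathcal{X}$. (iii) $\lim_{k\to\infty}F(x^k)$ and $\lim_{k\to\infty}E(x^k,x^{k-1})$ exist, and $$\lim_{k\to\infty}F(x^k)=\lim_{k\to\infty}E(x^k,x^{k-1})=F(\hat x)\qquad\text{for all }\hat x\in\omega(x^k).$$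
   Context: $\mathbb{R}^n$ carries the Euclidean inner product $\langle\cdot,\cdot\rangle$ and norm $\|\cdot\|$. Standing assumptions: $f:\mathbb{R}^n\to\mathbb{R}$ is a smooth convex function whose gradient is Lipschitz continuous with constant $L_f>0$; $g:\mathbb{R}^n\to(-\infty,+\infty]$ is proper, convex, lower semicontinuous and prox friendly; $h:\mathbb{R}^n\to\mathbb{R}$ is convex; and $F:=f+g-h$ is level-bounded, i.e. $\{x\in\mathbb{R}^n:F(x)\le r\}$ is bounded for each $r\in\mathbb{R}$. $\partial g,\partial h$ denote convex subdifferentials: $\partial\varphi(u)=\{\xi\in\mathbb{R}^n:\varphi(z)\ge\varphi(u)+\langle\xi,z-u\rangle\ \forall z\in\mathbb{R}^n\}$. ${\rm Prox}_{\mu g}(x)$ is the unique minimizer over $y\in\mathbb{R}^n$ of $g(y)+\frac{1}{2\mu}\|x-y\|^2$. A point $\hat x\in\mathbb{R}^n$ is a critical point of $F$ if $0\in\nabla f(\hat x)+\partial g(\hat x)-\partial h(\hat x)$; $\mathcal{X}$ is the set of all critical points of $F$. $\omega(x^k)$ is the set of limits of convergent subsequences of $\{x^k\}_{k=0}^\infty$. Algorithm cDCA. Take ${\rm tol}>0$ and $x^{-1},x^0\in\mathbb{R}^n$ with $x^{-1}\ne x^0$. Select $\lambda>0$ and $\delta\in(0,\frac{2\lambda}{L_f})$ arbitrarily, and set $\mu=\frac{2}{2\lambda+L_f}$. For $k=0,1,2,\dots$: Step 1. For the iterate $x^k$, select $x_0^{k+1}\in\mathbb{R}^n$ (arbitrary),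 take any $\eta^k\in\partial h(x^k)$, and compute for $m=1,\dots,m_k$ $$x_m^{k+1}={\rm Prox}_{\mu g}\big[(1-\mu\lambda)x_{m-1}^{k+1}-\mu\nabla f(x_{m-1}^{k+1})+\mu\lambda x^k+\mu\eta^k\big],\qquad( * )$$ where $m_k$ is the smallest positive integer such that $\|x^{k+1}_{m_k}-x^{k+1}_{m_k-1}\|\le\delta\|x^{k-1}-x^k\|$. Step 2. If $\|x^{k+1}_{m_k}-x^k\|/\max\{1,\|x^k\|\}\ge{\rm tol}$, set $x^{k+1}=x^{k+1}_{m_k}$. Otherwise, compute $x^{k+1}_{m_k+1}$ via $( * )$ with $m=m_k+1$; if $\|x^{k+1}_{m_k+1}-x^k\|/\max\{1,\|x^k\|\}<{\rm tol}$, stop; otherwise set $x^{k+1}=x^{k+1}_{m_k+1}$. Then pass to the next $k$ and return to Step 1. It is assumed that cDCA does not terminate in finitely many iterations, and hence generates an infinite sequence $\{x^k\}_{k=0}^\infty$. *)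

(* Defs.v *)
From HB Require Import structures.
From mathcomp Require Export all_boot all_order all_algebra.
From mathcomp Require Export all_classical all_reals all_analysis.

Set Implicit Arguments.
Unset Strict Implicit.
Unset Printing Implicit Defensive.

Import Order.TTheory GRing.Theory Num.Theory.
Import numFieldNormedType.Exports.

Local Open Scope classical_set_scope.
Local Open Scope ring_scope.

Section Euclidean.
Context {R : realType} {n : nat}.
Implicit Types x y : 'rV[R]_n.

(* The norm [`|x|] that MathComp-Analysis puts on ['rV[R]_n] is the max norm.
   It is used only through notions that do not distinguish equivalent norms
   (convergence, differentiability, semicontinuity, boundedness); every metric
   quantity below is expressed with [enorm]. *)
Definition dot x y : R := \sum_(i < n) x 0 i * y 0 i.

Definition enorm x : R := Num.sqrt (dot x x).

Definition gradient (f : 'rV[R]_n -> R) x : 'rV[R]_n :=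
  \row_(i < n) 'D_(delta_mx 0 i) f x.

End Euclidean.

Section ConvexAnalysis.
Context {R : realType} {n : nat}.
Implicit Types (phi g : 'rV[R]_n -> \bar R) (x u : 'rV[R]_n).
Local Open Scope ereal_scope.

Definition proper phi : Prop :=
  (forall x, phi x != -oo) /\ (exists x, phi x < +oo).

(* Meant for functions that avoid -oo, so that the right-hand side is never
   of the form +oo - oo; recall that 0 * +oo = 0 in [\bar R]. *)
Definition econvex phi : Prop :=
  forall (t : R) x y, (0 <= t <= 1)%R ->
    phi (t *: x + (1 - t) *: y)%R <= t%:E * phi x + (1 - t)%:E * phi y.

Definition level_bounded phi : Prop :=
  forall r : R, bounded_set [set x | phi x <= r%:E].

Definition subdifferential phi u : set 'rV[R]_n :=
  [set xi | forall z, phi u + (dot xi (z - u))%:E <= phi z].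

Definition prox_objective (mu : R) g x y : \bar R :=
  g y + ((2 * mu)^-1 * enorm (x - y) ^+ 2)%:E.

(* [is_prox mu g x p] states p = Prox_{mu g}(x): p is the unique minimizer. *)
Definition is_prox (mu : R) g x p : Prop :=
  (forall y, prox_objective mu g x p <= prox_objective mu g x y) /\
  (forall q, (forall y, prox_objective mu g x q <= prox_objective mu g x y) ->
     q = p).

End ConvexAnalysis.

Section DCProgram.
Context {R : realType} {n : nat}.
Variables (f : 'rV[R]_n -> R) (g : 'rV[R]_n -> \bar R) (h : 'rV[R]_n -> R).
Implicit Types x y : 'rV[R]_n.

Definition objective x : \bar R := ((f x)%:E + g x - (h x)%:E)%E.

Definition critical_points : set 'rV[R]_n :=
  [set x | exists xi zeta, [/\ subdifferential g x xi,
     subdifferential (EFin \o h) x zeta & 0 = gradient f x + xi - zeta]].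

Definition energy (tau : R) x y : \bar R :=
  (objective x + (tau * enorm (x - y) ^+ 2)%:E)%E.

Variables (lambda mu delta tol : R).

(* [p] is obtained from [y] by the inner proximal-gradient update attached to
   the outer iterate [xk] and the subgradient [eta]. *)
Definition inner_update (xk eta y p : 'rV[R]_n) : Prop :=
  is_prox mu g ((1 - mu * lambda) *: y - mu *: gradient f y
                + (mu * lambda) *: xk + mu *: eta) p.

Definition inner_stop (xprev xk : 'rV[R]_n) (y : nat -> 'rV[R]_n) (m : nat)
  : Prop := enorm (y m - y m.-1) <= delta * enorm (xprev - xk).

Definition relative_change (xk z : 'rV[R]_n) : R :=
  enorm (z - xk) / Num.max 1 (enorm xk).

(* One non-terminating outer iteration, producing [xnext] from [xk] and the
   preceding iterate [xprev]; [y m] is the m-th inner iterate. *)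
Definition cDCA_step (xprev xk xnext : 'rV[R]_n) : Prop :=
  exists (eta : 'rV[R]_n) (y : nat -> 'rV[R]_n) (m : nat),
  [/\ subdifferential (EFin \o h) xk eta,
      forall j, (0 < j <= m)%N -> inner_update xk eta (y j.-1) (y j),
      (0 < m)%N /\ inner_stop xprev xk y m,
      forall j, (0 < j < m)%N -> ~ inner_stop xprev xk y j &
      (tol <= relative_change xk (y m) /\ xnext = y m) \/
      [/\ relative_change xk (y m) < tol,
          inner_update xk eta (y m) (y m.+1),
          tol <= relative_change xk (y m.+1) & xnext = y m.+1]].

(* x^{k-1}, where [xm1] is the extra starting point x^{-1}. *)
Definition previous (xm1 : 'rV[R]_n) (x : nat -> 'rV[R]_n) (k : nat) :=
  if k is k'.+1 then x k' else xm1.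

(* [cDCA_sequence] makes sense for every tol >= 0.  If tol > 0, each step has
   enorm (xnext - xk) >= tol, so an infinite run cannot have consecutive
   differences tending to 0; tol = 0 removes this restriction, and the second
   branch of [cDCA_step] is then never taken. *)
Definition cDCA_sequence (xm1 : 'rV[R]_n) (x : nat -> 'rV[R]_n) : Prop :=
  xm1 <> x 0 /\ forall k, cDCA_step (previous xm1 x k) (x k) (x k.+1).

End DCProgram.

Definition subsequential_limits {R : realType} {n : nat}
    (x : nat -> 'rV[R]_n) : set 'rV[R]_n :=
  [set l | exists2 s : nat -> nat, increasing_seq s & (x \o s) @ \oo --> l].

(* Main.v *)
(** Writing [d = x_k - x_{k+1}], the optimality condition of the proximal update
    exhibits subgradients [xi] of [g] at [x_{k+1}] and [eta] of [h] at [x_k]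
    such that [grad f x_{k+1} + xi - eta = lambda d + r] with [r = (L/2) (y
    - x_{k+1}) - (grad f y - grad f x_{k+1})] and [y] the inner iterate
    preceding [x_{k+1}]; the choice of [mu] turns [1 - mu lambda] into [mu
    L/2]. Cocoercivity of [grad f] gives [|r| <= (L/2) |y - x_{k+1}|], and
    the stopping rule bounds this by [(L delta/2) |x_k - x_{k-1}|]; an extra
    inner update only shrinks [|y - x_{k+1}|], being a contraction. Adding
    the three subgradient inequalities and completing the square in [lambda
    |d|^2 + <r, d>] yields the decrease of the energy. Hence [d] and [r]
    tend to 0 and the optimality condition passes to the limit: [h], being
    finite and convex, is continuous with locally bounded subgradients, and
    lower semicontinuity of [g] together with the subgradient inequality for
    [g] at [x_{k+1}] identifies the limit of [g x_{k+1}]. *)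

Require Import Defs.
From mathcomp Require Import ring lra.

Set Implicit Arguments.
Unset Strict Implicit.
Unset Printing Implicit Defensive.

Import Order.TTheory GRing.Theory Num.Theory.
Import numFieldNormedType.Exports.

Local Open Scope classical_set_scope.
Local Open Scope ring_scope.

(** * Euclidean inner product and its link with the max-norm topology *)

Section Dot.
Context {R : realType} {n : nat}.
Implicit Types (x y z : 'rV[R]_n) (a c : R).

Lemma dotC x y : dot x y = dot y x.
Proof. by apply: eq_bigr => i _; rewrite mulrC. Qed.

Lemma dotDl x y z : dot (x + y) z = dot x z + dot y z.
Proof. by rewrite -big_split; apply: eq_bigr => i _; rewrite mxE mulrDl. Qed.

Lemma dotZl a x y : dot (a *: x) y = a * dot x y.
Proof. by rewrite mulr_sumr; apply: eq_bigr => i _; rewrite mxE mulrA. Qed.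

Lemma dotNl x y : dot (- x) y = - dot x y.
Proof. by rewrite -scaleN1r dotZl mulN1r. Qed.

Lemma dotDr x y z : dot z (x + y) = dot z x + dot z y.
Proof. by rewrite !(dotC z) dotDl. Qed.

Lemma dotZr a x y : dot y (a *: x) = a * dot y x.
Proof. by rewrite !(dotC y) dotZl. Qed.

Lemma dotNr x y : dot y (- x) = - dot y x.
Proof. by rewrite !(dotC y) dotNl. Qed.

Definition dotE := (dotDl, dotDr, dotNl, dotNr, dotZl, dotZr).

Lemma dot0l x : dot 0 x = 0.
Proof. by rewrite -(scale0r x) dotZl mul0r. Qed.

Lemma dot0r x : dot x 0 = 0.
Proof. by rewrite dotC dot0l. Qed.

Lemma dotxx_ge0 x : 0 <= dot x x.
Proof. by apply: sumr_ge0 => i _; rewrite -expr2 sqr_ge0. Qed.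

Lemma enormE x : enorm x ^+ 2 = dot x x.
Proof. by rewrite sqr_sqrtr// dotxx_ge0. Qed.

Lemma enorm_leE a x y : 0 <= a ->
  (enorm x <= a * enorm y) = (dot x x <= a ^+ 2 * dot y y).
Proof.
move=> a0; rewrite -ler_sqr ?nnegrE ?sqrtr_ge0//; last first.
  by rewrite mulr_ge0// sqrtr_ge0.
by rewrite exprMn !enormE.
Qed.

Lemma dotBC x y : dot (x - y) (x - y) = dot (y - x) (y - x).
Proof. by rewrite -(opprB y x) dotNl dotNr opprK. Qed.

Lemma enormBC x y : enorm (x - y) = enorm (y - x).
Proof. by rewrite /enorm dotBC. Qed.

Lemma norm_le_enorm x : `|x| <= enorm x.
Proof.
rewrite /Num.norm/= mx_normrE; apply: bigmax_le; rewrite ?sqrtr_ge0//.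
move=> -[i j] _ /=.
rewrite ord1 -sqrtr_sqr ler_wsqrtr// /dot (bigD1 j)//= expr2 lerDl.
by apply: sumr_ge0 => k _; rewrite -expr2 sqr_ge0.
Qed.

Lemma dot_delta x i : dot x (delta_mx 0 i) = x 0 i.
Proof.
rewrite /dot (bigD1 i)//= mxE !eqxx mulr1 big1 ?addr0// => j ji.
by rewrite mxE (negbTE ji) andbF mulr0.
Qed.

Lemma coord_le_mx_norm x i : `|x 0 i| <= `|x|.
Proof.
rewrite [leRHS]/Num.norm/= mx_normrE.
exact: (le_bigmax _ (fun ij : 'I_1 * 'I_n => `|x ij.1 ij.2|) (0, i)).
Qed.

Lemma cvg_dot {T} (F : set_system T) {FF : ProperFilter F}
    (u v : T -> 'rV[R]_n) x y :
  u @ F --> x -> v @ F --> y -> (fun k => dot (u k) (v k)) @ F --> dot x y.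
Proof.
move=> ux vy; rewrite /dot.
have cc (w : T -> 'rV[R]_n) (a : 'rV[R]_n) : w @ F --> a ->
    forall i, (fun k => w k 0 i) @ F --> a 0 i.
  move=> wa i; exact: (cvg_comp _ _ wa (@coord_continuous R 1 n 0 i a)).
apply: cvg_big => [|i _]; last by apply: cvgM; exact: cc.
exact: add_continuous.
Qed.

(** Limits live in the max-norm topology while the estimates are Euclidean; squeezing the max norm
    under [enorm] passes from one to the other. *)
Lemma cvg0_dot {T} (F : set_system T) {FF : ProperFilter F}
    (u : T -> 'rV[R]_n) :
  (fun k => dot (u k) (u k)) @ F --> (0 : R) -> u @ F --> (0 : 'rV[R]_n).
Proof.
move=> u0; apply/norm_cvg0P.
apply: (@squeeze_cvgr _ _ _ _ (cst 0) (enorm \o u)).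
- by apply: nearW => k /=; rewrite normr_ge0 norm_le_enorm.
- exact: cvg_cst.
- rewrite -[X in _ --> X]sqrtr0.
  exact: (cvg_comp _ _ u0 (@sqrt_continuous R 0)).
Qed.

End Dot.

(** * Smooth convex functions: gradient inequality, descent and cocoercivity *)

Section Smooth.
Context {R : realType} {n : nat}.
Implicit Types (f : 'rV[R]_n -> R) (x y z d : 'rV[R]_n).

Lemma convex_functionE f : convex_function [set: 'rV[R]_n] f ->
  forall (t : R) x y, 0 <= t <= 1 ->
    f (t *: x + (1 - t) *: y) <= t * f x + (1 - t) * f y.
Proof.
move=> cf t x y /andP[t0 t1].
have t01 : Itv.spec (@Itv.num_sem R) (Itv.Real `[0%Z, 1%Z]) t.
  by apply/andP; split; rewrite ?num_real// in_itv/= t0 t1.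
have := cf (Itv.mk t01) x y.
by rewrite !in_setT; apply.
Qed.

Lemma derive_dot f x d : differentiable f x -> 'D_d f x = dot (gradient f x) d.
Proof.
move=> df; rewrite deriveE// {1}[d]row_sum_delta linear_sum /dot.
by apply: eq_bigr => i _; rewrite linearZ/= mxE deriveE// mulrC.
Qed.

Lemma is_derive_line f x d t : differentiable f (x + t *: d) ->
  is_derive t 1 (fun s => f (x + s *: d)) (dot (gradient f (x + t *: d)) d).
Proof.
move=> df.
have E : (fun h => h^-1 *: (((fun s => f (x + s *: d)) \o shift t) (h *: 1)
    - f (x + t *: d))) =
  (fun h => h^-1 *: ((f \o shift (x + t *: d)) (h *: d) - f (x + t *: d))).
  apply/funext => h /=; congr (_ *: (f _ - _)).
  by rewrite [h *: 1]mulr1 scalerDl addrCA.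
split.
  by rewrite /derivable E; exact: diff_derivable.
by rewrite /derive E -/(derive _ _ _) derive_dot.
Qed.

(** Convexity bounds the difference quotient of [f] at [x] along [z - x] by [f z - f x] for every
    step in []0, 1]]; let the step tend to 0 from the right. *)
Lemma convex_gradient_le f x z : convex_function [set: 'rV[R]_n] f ->
  differentiable f x -> f x + dot (gradient f x) (z - x) <= f z.
Proof.
move=> /convex_functionE cf df; rewrite -lerBrDl -derive_dot//.
have dv := @diff_derivable _ _ _ f x (z - x) df.
have sub : (0:R)^'+ `=>` (0:R)^'.
  move=> A; rewrite /dnbhs /at_right /within/=; apply: filterS => t + t0.
  by apply; rewrite gt_eqF.
have {}dv := cvg_trans (cvg_app _ sub) dv.
apply: (cvgr_to_le dv).
near=> t.
have t0 : 0 < t by [].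
have t1 : t <= 1 by near: t; exact: nbhs_right_le.
have := cf t z x; rewrite (ltW t0) t1 => /(_ isT) H.
rewrite /= ler_pdivrMl//.
have -> : t *: (z - x) + x = t *: z + (1 - t) *: x.
  by rewrite scalerBr scalerBl scale1r -addrA [- _ + _]addrC.
by lra.
Unshelve. all: by end_near. Qed.


(** Along the segment, [f] minus its quadratic model has nonpositive derivative; the mean value
    theorem then compares the endpoints. *)
Lemma descent f (L : R) x y : 0 < L -> (forall u, differentiable f u) ->
  (forall u v, enorm (gradient f u - gradient f v) <= L * enorm (u - v)) ->
  f y <= f x + dot (gradient f x) (y - x) + L / 2 * dot (y - x) (y - x).
Proof.
move=> L0 df Lf; rewrite -{1}(subrK x y) [_ + x]addrC; move: (y - x) => d.
set a := dot _ d; set c := dot d d.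
pose phi s := f (x + s *: d) - (a * s + L / 2 * c * s ^+ 2).
pose dphi s := dot (gradient f (x + s *: d)) d - (a + L * c * s).
have dphiE (s : R) : is_derive s 1 phi (dphi s).
  rewrite /phi /dphi; have df' := is_derive_line (df (x + s *: d)).
  apply: is_deriveB; apply: is_derive_eq.
  by rewrite /GRing.scale/=; field.
have [|s] := @MVT R phi dphi 0 1 ltr01 (fun s _ => dphiE s).
  by apply: derivable_within_continuous => s _; exact: ex_derive.
rewrite in_itv/= => /andP[s0 s1].
have : dphi s <= 0.
  rewrite /dphi; set G := gradient f (x + s *: d).
  have := Lf (x + s *: d) x.
  rewrite enorm_leE ?(ltW L0)// -/G [x + _]addrC addrK.
  set v := G - _.
  have -> : dot G d = dot v d + a by rewrite /v dotDl dotNl subrK.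
  (* This square replaces Cauchy-Schwarz: combined with [|v| <= L s |d|] it gives
     [<v, d> <= L s |d|^2]. *)
  have := dotxx_ge0 (v - (L * s) *: d); clearbody v.
  rewrite !dotE (dotC d v) -/c => H1 H2.
  have Ls : 0 < L * s by rewrite mulr_gt0.
  rewrite -(pmulr_rle0 _ Ls).
  by nra.
rewrite subr0 mulr1 => H; rewrite /phi scale1r scale0r addr0.
by nra.
Qed.

(* The minimum of [z |-> f z - <grad f x, z>] is attained at [x], and descent
   from [y] along the gradient of that function bounds the minimum value. *)
Lemma convex_gradient_gap f (L : R) x y : convex_function [set: 'rV[R]_n] f ->
  0 < L -> (forall u, differentiable f u) ->
  (forall u v, enorm (gradient f u - gradient f v) <= L * enorm (u - v)) ->
  dot (gradient f y - gradient f x) (gradient f y - gradient f x) <=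
  2 * L * (f y - f x - dot (gradient f x) (y - x)).
Proof.
move=> cf L0 df Lf; set G := gradient f y - _; pose z := y - L^-1 *: G.
have := descent y z L0 df Lf; have := convex_gradient_le z cf (df x).
rewrite (_ : z - y = - (L^-1 *: G)); last by rewrite /z [LHS]addrC addKr.
rewrite (_ : z - x = (y - x) - L^-1 *: G); last by rewrite /z addrAC.
set b := dot _ (y - x).
have -> : dot (gradient f x) (y - x - L^-1 *: G) =
    b - L^-1 * dot (gradient f x) G.
  by rewrite dotDr dotNr dotZr.
rewrite !(dotNr, dotNl, dotZr, dotZl) opprK.
have -> : dot (gradient f y) G = dot G G + dot (gradient f x) G.
  by rewrite -dotDl subrK.
move: (dot G G) (dot _ G) => g2 e H1 H2.
have : f x + b + L^-1 / 2 * g2 <= f y.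
  have E : L / 2 * (L^-1 * (L^-1 * g2)) = L^-1 / 2 * g2 by field; lra.
  by rewrite E in H2; nra.
move=> H; have : 2 * L * (L^-1 / 2 * g2) <= 2 * L * (f y - f x - b).
  by rewrite ler_pM2l; lra.
by rewrite (_ : 2 * L * (L^-1 / 2 * g2) = g2)//; field; lra.
Qed.

(* Baillon-Haddad *)
Lemma gradient_cocoercive f (L : R) x y : convex_function [set: 'rV[R]_n] f ->
  0 < L -> (forall u, differentiable f u) ->
  (forall u v, enorm (gradient f u - gradient f v) <= L * enorm (u - v)) ->
  dot (gradient f x - gradient f y) (gradient f x - gradient f y) <=
  L * dot (gradient f x - gradient f y) (x - y).
Proof.
move=> cf L0 df Lf; set G := gradient f x - gradient f y.
(* Adding the gap bounds for both orders of the points cancels the function values. *)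
have := convex_gradient_gap x y cf L0 df Lf.
have := convex_gradient_gap y x cf L0 df Lf.
rewrite /= -/G -(opprB (gradient f x)) -/G dotNl dotNr opprK.
rewrite -(opprB x) dotNr /G.
move: (dot (gradient f x - _) (_ - _)) => g2 /=.
rewrite (dotDl _ _ (x - y)) dotNl.
by nra.
Qed.

(** Expanding the square leaves [|G|^2 - L <d, G>] as the excess over the right-hand side, which
    cocoercivity makes nonpositive. *)
Lemma gradient_step_le f (L : R) x y : convex_function [set: 'rV[R]_n] f ->
  0 < L -> (forall u, differentiable f u) ->
  (forall u v, enorm (gradient f u - gradient f v) <= L * enorm (u - v)) ->
  dot ((L / 2) *: (x - y) - (gradient f x - gradient f y))
      ((L / 2) *: (x - y) - (gradient f x - gradient f y)) <=
  (L / 2) ^+ 2 * dot (x - y) (x - y).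
Proof.
move=> cf L0 df Lf.
have := gradient_cocoercive x y cf L0 df Lf.
move: (x - y) (_ - gradient f y) => d G /=.
by rewrite !dotE (dotC d G); nra.
Qed.

End Smooth.

(** * Subgradients and proximal maps *)

Section Prox.
Context {R : realType} {n : nat}.
Implicit Types (g : 'rV[R]_n -> \bar R) (x y z p xi : 'rV[R]_n) (mu : R).

Lemma le_of_affine_perturbation (A B C : R) :
  (forall t, 0 < t <= 1 -> B <= A + t * C) -> B <= A.
Proof.
move=> H; apply: (@cvgr_to_ge _ ((0:R)^'+) _ _ (fun t => A + t * C)).
  apply: cvg_at_right_filter; rewrite -[X in _ --> X](addr0 A).
  apply: cvgD; first exact: cvg_cst.
  by rewrite -[X in _ --> X](mul0r C); apply: cvgM => //; exact: cvg_cst.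
near=> t; apply: H; apply/andP; split; first by [].
by near: t; exact: nbhs_right_le.
Unshelve. all: by end_near. Qed.

Lemma subdifferential_monotone g x y xi zeta :
  g x \is a fin_num -> g y \is a fin_num ->
  subdifferential g x xi -> subdifferential g y zeta ->
  0 <= dot (xi - zeta) (x - y).
Proof.
move=> /fineK gx /fineK gy /(_ y) + /(_ x).
rewrite -gx -gy -!EFinD !lee_fin -(opprB x y) dotNr dotDl dotNl.
by lra.
Qed.

Lemma prox_fin_num mu g x p : proper g ->
  (forall y, (prox_objective mu g x p <= prox_objective mu g x y)%E) ->
  g p \is a fin_num.
Proof.
move=> [gN [y gy]] /(_ y); rewrite /prox_objective fin_numE gN/=.
apply: contraTN => /eqP ->; rewrite addye// leye_eq.
by rewrite -ltey lte_add_pinfty// ltry.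
Qed.

(** Compare the minimizer [p] with [t z + (1 - t) p]: after division by [t], the quadratic term in
    [z - p] carries a factor [t] and vanishes as [t] tends to 0. *)
Lemma prox_subdifferential mu g x p : 0 < mu -> proper g -> econvex g ->
  (forall y, (prox_objective mu g x p <= prox_objective mu g x y)%E) ->
  subdifferential g p (mu^-1 *: (x - p)).
Proof.
move=> mu0 gp cg pmin z.
have /fineK gpE := prox_fin_num gp pmin.
have gN := gp.1.
have [gz|gz] := eqVneq (g z) +oo%E; first by rewrite gz leey.
have /fineK gzE : g z \is a fin_num by rewrite fin_numE gN gz.
rewrite -gpE -gzE -EFinD lee_fin dotZl -lerBrDl.
set c := (2 * mu)^-1.
have c0 : 0 < c by rewrite invr_gt0; lra.
apply: (@le_of_affine_perturbation _ _ (c * dot (z - p) (z - p))).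
move=> t /andP[t0 t1].
have := cg t z p; rewrite (ltW t0) t1 => /(_ isT) H1.
have := pmin (t *: z + (1 - t) *: p); rewrite /prox_objective => H2.
have {H1 H2} := le_trans H2 (leeD2r _ H1).
rewrite -gpE -gzE -!EFinM -!EFinD lee_fin !enormE -/c.
have -> : x - (t *: z + (1 - t) *: p) = (x - p) - t *: (z - p).
  by apply/rowP => i; rewrite !mxE; lra.
have -> : mu^-1 = 2 * c by rewrite /c; field; lra.
move: (x - p) (z - p) => a b; rewrite !dotE (dotC b a) => H.
rewrite -(ler_pM2l t0).
by nra.
Qed.

(** With [a = x - y] and [b = p - q], monotonicity of the subdifferential gives [|b|^2 <= <a, b>],
    and [2 <a, b> <= |a|^2 + |b|^2]. *)
Lemma prox_nonexpansive mu g x y p q : 0 < mu -> proper g -> econvex g ->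
  (forall z, (prox_objective mu g x p <= prox_objective mu g x z)%E) ->
  (forall z, (prox_objective mu g y q <= prox_objective mu g y z)%E) ->
  dot (p - q) (p - q) <= dot (x - y) (x - y).
Proof.
move=> mu0 gp cg xp yq.
have := subdifferential_monotone (prox_fin_num gp xp) (prox_fin_num gp yq)
  (prox_subdifferential mu0 gp cg xp) (prox_subdifferential mu0 gp cg yq).
rewrite -scalerBr dotZl pmulr_rge0 ?invr_gt0//.
rewrite (_ : x - p - (y - q) = (x - y) - (p - q)); last first.
  by apply/rowP => i; rewrite !mxE; lra.
move: (x - y) (p - q) => a b.
have := dotxx_ge0 (a - b); rewrite !dotE (dotC b a).
by lra.
Qed.

End Prox.

(** * Local Lipschitz bounds for finite convex functions *)

Section ConvexLipschitz.
Context {R : realType} {n : nat}.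
Implicit Types (h : 'rV[R]_n -> R) (x y : 'rV[R]_n) (M : R).

Lemma convex_bounded_above_line h x M : convex_function [set: 'rV[R]_n] h ->
  exists B, forall a, `|a| <= M -> h (a *: x) <= B.
Proof.
move=> /convex_functionE ch; pose N := Num.max 1 M.
exists (`|h (N *: x)| + `|h (- N *: x)|) => a aM.
have N0 : 0 < N by rewrite lt_max ltr01.
have : `|a| <= N by rewrite le_max aM orbT.
rewrite ler_norml => /andP[a1 a2].
(* The weight that writes [a] as a convex combination of [N] and [- N]; the maximum with 1 keeps [N]
   positive. *)
pose t := (a + N) / (2 * N).
have t0 : 0 <= t by rewrite divr_ge0//; lra.
have t1 : t <= 1 by rewrite ler_pdivrMr; lra.
have := ch t (N *: x) (- N *: x); rewrite t0 t1 => /(_ isT).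
rewrite !scalerA -scalerDl (_ : t * N + (1 - t) * - N = a); last first.
  by rewrite /t; field; lra.
move=> /le_trans; apply.
have := ler_norm (h (N *: x)); have := ler_norm (h (- N *: x)).
have := normr_ge0 (h (N *: x)); have := normr_ge0 (h (- N *: x)).
by nra.
Qed.

(* Averaging [2 x_i e_i] with twice the remaining coordinates reduces the bound
   to one dimension. *)
Lemma convex_bounded_above h M : convex_function [set: 'rV[R]_n] h ->
  exists B, forall x, `|x| <= M -> h x <= B.
Proof.
move=> ch.
suff [B hB] : exists B, forall a : 'I_n -> R, (forall i, `|a i| <= M) ->
    h (\sum_(i <- index_enum 'I_n) a i *: delta_mx 0 i) <= B.
  exists B => x xM; rewrite [x]row_sum_delta; apply: hB => i.
  exact: le_trans (coord_le_mx_norm _ _) xM.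
elim: (index_enum _) M => [|i s IH] M.
  by exists (h 0) => a _; rewrite big_nil.
have [B1 hB1] := convex_bounded_above_line (delta_mx 0 i) (2 * M) ch.
have [B2 hB2] := IH (2 * M).
have n2 (b : R) : `|2 * b| = 2 * `|b| by rewrite normrM ger0_norm.
exists (2^-1 * (B1 + B2)) => a aM; rewrite big_cons.
have := hB1 (2 * a i); rewrite n2 ler_pM2l// => /(_ (aM i)) H1.
have := hB2 (fun j => 2 * a j) => /(_ _)/wrap[].
  by move=> j; rewrite n2 ler_pM2l.
move=> H2.
have half : 0 <= (2^-1 : R) <= 1 by lra.
have := convex_functionE ch ((2 * a i) *: delta_mx 0 i)
  (\sum_(j <- s) (2 * a j) *: delta_mx 0 j) half.
rewrite (_ : 1 - 2^-1 = 2^-1 :> R); last by lra.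
rewrite scalerA mulKf// scaler_sumr.
have -> : \sum_(j <- s) 2^-1 *: ((2 * a j) *: delta_mx 0 j) =
    \sum_(j <- s) a j *: delta_mx 0 j :> 'rV[R]_n.
  by apply: eq_bigr => j _; rewrite scalerA mulKf.
by lra.
Qed.

(** Prolong the segment from [y] to [x] by unit length to [w]: then [x] is a convex combination of
    [w] and [y] whose weight on [w] is at most [|x - y|]. *)
Lemma convex_lipschitz h M : convex_function [set: 'rV[R]_n] h ->
  exists K, forall x y, `|x| <= M -> `|y| <= M -> h x - h y <= K * `|x - y|.
Proof.
move=> ch; have [B hB] := convex_bounded_above (M + 1) ch.
(* On the larger ball [h] is at most [B]; reflecting [y] through 0 also bounds it below by
   [2 h 0 - B]. The constant is the gap between the two bounds. *)
exists (2 * (B - h 0)) => x y xM yM.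
have [->|xy] := eqVneq x y; first by rewrite !subrr normr0 mulr0.
set s := `|x - y|; have s0 : 0 < s by rewrite normr_gt0 subr_eq0.
have M0 : 0 <= M := le_trans (normr_ge0 x) xM.
have h0 : h 0 <= B by apply: hB; rewrite normr0; lra.
have hNy : h (- y) <= B by apply: hB; rewrite normrN; lra.
have hy : 2 * h 0 - B <= h y.
  have half : 0 <= (2^-1 : R) <= 1 by lra.
  have := convex_functionE ch y (- y) half.
  rewrite (_ : 1 - 2^-1 = 2^-1 :> R); last by lra.
  by rewrite scalerN subrr; lra.
pose w := x + s^-1 *: (x - y); pose t := s / (1 + s).
have hw : h w <= B.
  apply: hB; apply: (le_trans (ler_normD _ _)); rewrite lerD//.
  by rewrite normrZ gtr0_norm ?invr_gt0// mulVf ?gt_eqF.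
have t0 : 0 <= t by rewrite divr_ge0//; lra.
have t1 : t <= 1 by rewrite ler_pdivrMr; lra.
have ts : t <= s by rewrite ler_pdivrMr; nra.
have := convex_functionE ch w y (t := t); rewrite t0 t1 => /(_ isT).
rewrite (_ : t *: w + (1 - t) *: y = x); last first.
  by apply/rowP => i; rewrite !mxE /t; field; lra.
by nra.
Qed.

Lemma convex_continuous h : convex_function [set: 'rV[R]_n] h -> continuous h.
Proof.
move=> ch x; have [K hK] := convex_lipschitz (`|x| + 1) ch.
apply/(@cvgrPdist_le _ _ _ _ (nbhs_filter x)) => e e0.
(* [K] carries no sign information, so the modulus of continuity uses the positive number
   [|K| + 1]. *)
have K1 : 0 < `|K| + 1 by have := normr_ge0 K; lra.
near=> y.
have yx : `|x - y| <= e / (`|K| + 1).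
  by near: y; apply: cvgr_dist_le; rewrite ?divr_gt0//; exact: cvg_id.
have y1 : `|x - y| <= 1.
  by near: y; apply: cvgr_dist_le; rewrite ?ltr01//; exact: cvg_id.
have yM : `|y| <= `|x| + 1.
  rewrite -[y](subKr x) (le_trans (ler_normB _ _))// lerD2l//.
have xM : `|x| <= `|x| + 1 by lra.
have Ke : K * `|x - y| <= e.
  rewrite (le_trans (_ : _ <= (`|K| + 1) * `|x - y|))//; last first.
    by rewrite mulrC -ler_pdivlMr.
  by rewrite ler_wpM2r//; have := ler_norm K; lra.
have := hK _ _ xM yM; have := hK _ _ yM xM; rewrite (distrC y x) ler_norml.
by lra.
Unshelve. all: by end_near. Qed.

(** Coordinates of [eta] are its pairings with unit vectors, and such a pairing is at most the
    increment of [h] over a unit step, hence the Lipschitz bound on radius [M + 1]. *)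
Lemma convex_subdifferential_bounded h M : convex_function [set: 'rV[R]_n] h ->
  exists K, forall x eta, `|x| <= M -> subdifferential (EFin \o h) x eta ->
    `|eta| <= K.
Proof.
move=> ch; have [K hK] := convex_lipschitz (M + 1) ch.
exists `|K| => x eta xM sub.
rewrite [leLHS]/Num.norm/= mx_normrE; apply: bigmax_le => // -[i j] _ /=.
rewrite (ord1 i) {i}.
have M0 : 0 <= M := le_trans (normr_ge0 x) xM.
have n1 : `|delta_mx 0 j : 'rV[R]_n| <= 1.
  rewrite [leLHS]/Num.norm/= mx_normrE; apply: bigmax_le => // -[i k] _ /=.
  by rewrite mxE; case: (_ && _); rewrite ?normr1 ?normr0.
have key (z : 'rV[R]_n) : `|z| <= 1 -> dot eta z <= `|K|.
  move=> z1; have := sub (x + z); rewrite /= -EFinD lee_fin [x + z]addrC addrK.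
  have zxM : `|z + x| <= M + 1 by have := ler_normD z x; lra.
  have xM1 : `|x| <= M + 1 by lra.
  have := hK _ _ zxM xM1; rewrite addrK.
  have : K * `|z| <= `|K|.
    rewrite (le_trans (_ : _ <= `|K| * `|z|))//.
      by rewrite ler_wpM2r// ler_norm.
    by rewrite ler_piMr.
  by lra.
rewrite ler_norml -(dot_delta eta j) lerNl -dotNr !key//.
by rewrite normrN.
Qed.

End ConvexLipschitz.

(** * One outer iteration: residual bound and descent inequality *)

Section Step.
Context {R : realType} {n : nat}.
Variables (f : 'rV[R]_n -> R) (g : 'rV[R]_n -> \bar R) (h : 'rV[R]_n -> R).
Variables (L lambda delta mu tol : R).
Hypotheses (f_convex : convex_function [set: 'rV[R]_n] f)
  (f_diff : forall u, differentiable f u) (L_gt0 : 0 < L)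
  (f_smooth : forall u v,
     enorm (gradient f u - gradient f v) <= L * enorm (u - v))
  (g_proper : proper g) (g_convex : econvex g)
  (lambda_gt0 : 0 < lambda) (delta_gt0 : 0 < delta)
  (muE : mu = 2 / (2 * lambda + L)).
Implicit Types (x y p q eta xi e : 'rV[R]_n).

Let den_gt0 : 0 < 2 * lambda + L.
Proof. by rewrite addr_gt0// mulr_gt0. Qed.

Lemma step_size_gt0 : 0 < mu.
Proof. by rewrite muE divr_gt0. Qed.

Lemma step_size_inv : mu^-1 = lambda + L / 2.
Proof. by rewrite muE; field; exact: lt0r_neq0. Qed.

Lemma one_sub_step_size_lambda : 1 - mu * lambda = mu * (L / 2).
Proof. by rewrite muE; field; exact: lt0r_neq0. Qed.

(** This measures the inexactness of the inner solve: it vanishes for some [xi] in the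
    subdifferential of [g] at [p] exactly when [p] minimizes the convex subproblem [f + g - <eta, .>
    + (lambda / 2) |. - xk|^2]. *)
Definition residual xk eta xi p : 'rV[R]_n :=
  xi + gradient f p + lambda *: (p - xk) - eta.

(** The prox inclusion supplies the subgradient [mu^-1 (a - p)]; as [mu^-1 = lambda + L / 2], the
    terms in [lambda] cancel and [gradient_step_le] bounds what remains. *)
Lemma inner_update_residual xk eta y p :
  inner_update f g lambda mu xk eta y p ->
  exists xi, [/\ subdifferential g p xi, g p \is a fin_num &
    dot (residual xk eta xi p) (residual xk eta xi p)
    <= (L / 2) ^+ 2 * dot (p - y) (p - y)].
Proof.
rewrite /inner_update; set a := (X in is_prox _ _ X _) => -[pmin _].
exists (mu^-1 *: (a - p)); split.
- exact: prox_subdifferential step_size_gt0 g_proper g_convex pmin.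
- exact: prox_fin_num g_proper pmin.
- have -> : residual xk eta (mu^-1 *: (a - p)) p =
      (L / 2) *: (y - p) - (gradient f y - gradient f p).
    have mu0 := step_size_gt0; have muV := step_size_inv.
    apply/rowP => i; rewrite /residual /a one_sub_step_size_lambda !mxE.
    have mu1 : mu^-1 * mu = 1 by rewrite mulVf// gt_eqF.
    move: (gradient f y 0 i) (gradient f p 0 i) => gy gp.
    rewrite !(mulrDr mu^-1) !mulrN !mulrA !mu1 muV.
    by field.
  rewrite dotBC; exact: gradient_step_le.
Qed.

(** The prox is nonexpansive and its arguments differ by at most [mu L / 2] times [|p - y|], where
    [mu L / 2 = 1 - mu lambda <= 1]. *)
Lemma inner_update_contraction xk eta y p q :
  inner_update f g lambda mu xk eta y p ->
  inner_update f g lambda mu xk eta p q ->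
  dot (q - p) (q - p) <= dot (p - y) (p - y).
Proof.
move=> [pmin _] [qmin _].
have mu0 := step_size_gt0.
apply: le_trans (prox_nonexpansive mu0 g_proper g_convex qmin pmin) _.
set a := (X in dot X X <= _).
have -> : a = mu *: ((L / 2) *: (p - y) - (gradient f p - gradient f y)).
  apply/rowP => i; rewrite /a one_sub_step_size_lambda !mxE.
  by move: (gradient f y 0 i) (gradient f p 0 i) => gy gp; ring.
rewrite dotZl dotZr mulrA -expr2.
have := gradient_step_le p y f_convex L_gt0 f_diff f_smooth.
move/(ler_wpM2l (sqr_ge0 mu))/le_trans; apply.
rewrite mulrA -exprMn ler_piMl ?dotxx_ge0//.
have ? : 0 < mu * lambda by rewrite mulr_gt0.
have ? : 0 <= mu * (L / 2) by rewrite mulr_ge0// ltW// divr_gt0.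
by rewrite expr_le1// -one_sub_step_size_lambda; lra.
Qed.

Lemma cDCA_step_residual xprev xk xnext :
  cDCA_step f g h lambda mu delta tol xprev xk xnext ->
  exists eta xi,
  [/\ subdifferential (EFin \o h) xk eta, subdifferential g xnext xi,
      g xnext \is a fin_num &
      dot (residual xk eta xi xnext) (residual xk eta xi xnext)
      <= (L * delta / 2) ^+ 2 * dot (xk - xprev) (xk - xprev)].
Proof.
move=> [eta [y [m [hx upd [m0]]]]].
rewrite /inner_stop enormBC (enormBC xprev) enorm_leE ?(ltW delta_gt0)//.
rewrite dotBC => stop _ last.
have updm := upd m; rewrite m0 leqnn in updm; have {}updm := updm isT.
(* In both branches the bound refers to the pair [y m.-1], [y m] of the stopping test; the extra
   update is brought back to it by contraction. *)
have [xi [xi1 xi2 xi3]] : exists xi, [/\ subdifferential g xnext xi,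
    g xnext \is a fin_num &
    dot (residual xk eta xi xnext) (residual xk eta xi xnext)
    <= (L / 2) ^+ 2 * dot (y m - y m.-1) (y m - y m.-1)].
  case: last => [[_ ->]|[_ updS _ ->]]; first exact: inner_update_residual updm.
  have [xi [xi1 xi2 xi3]] := inner_update_residual updS.
  exists xi; split => //; apply: (le_trans xi3).
  by rewrite ler_wpM2l ?sqr_ge0//; exact: inner_update_contraction updm updS.
exists eta, xi; split => //; apply: (le_trans xi3).
rewrite (_ : (L * delta / 2) ^+ 2 = (L / 2) ^+ 2 * delta ^+ 2); last by field.
by rewrite -mulrA ler_wpM2l ?sqr_ge0.
Qed.

(** Here [c] is the allowed loss, later [tau |xk - xprev|^2]. With [d = xk - p], the sum of the
    subgradient inequalities leaves [<r, d> + (lambda / 2) |d|^2], which is at least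
    [- |r|^2 / (2 lambda)]. *)
Lemma step_decrease c xk p eta xi : g xk \is a fin_num -> g p \is a fin_num ->
  subdifferential (EFin \o h) xk eta -> subdifferential g p xi ->
  dot (residual xk eta xi p) (residual xk eta xi p) <= 2 * lambda * c ->
  f p + fine (g p) - h p + lambda / 2 * dot (xk - p) (xk - p) <=
  f xk + fine (g xk) - h xk + c.
Proof.
move=> /fineK gxk /fineK gp /(_ p) + /(_ xk).
rewrite /= -gxk -gp -!EFinD !lee_fin => H1 H2 H3.
have H4 := convex_gradient_le xk f_convex (f_diff p).
have H5 := dotxx_ge0 (residual xk eta xi p + lambda *: (xk - p)).
suff : - (2 * lambda) * c <= 2 * lambda *
    (dot (gradient f p) (xk - p) + dot xi (xk - p) - dot eta (xk - p)
    - lambda / 2 * dot (xk - p) (xk - p)).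
  rewrite mulNr -mulrN ler_pM2l ?mulr_gt0//.
  by rewrite -(opprB xk p) dotNr in H1; lra.
have : dot (residual xk eta xi p) (xk - p) =
    dot (gradient f p) (xk - p) + dot xi (xk - p) - dot eta (xk - p)
    - lambda * dot (xk - p) (xk - p).
  by rewrite /residual -(opprB xk p) !(dotDl, dotNl, dotZl, dotZr, dotNr); ring.
move: H3 H5; move: (residual _ _ _ _) (xk - p) => r d H3.
rewrite !(dotDl, dotDr, dotZl, dotZr) (dotC d r) => H5 rd.
have : 0 <= dot r r + 2 * lambda * dot r d + lambda ^+ 2 * dot d d by lra.
rewrite rd.
by lra.
Qed.

End Step.

(** * Lower bounds and passage to the limit *)

Section Limits.
Context {R : realType} {n : nat}.
Implicit Types (f : 'rV[R]_n -> R) (g : 'rV[R]_n -> \bar R) (x y z : 'rV[R]_n).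

Lemma dot_ge_bounded x (M : R) : exists B, forall y, `|y| <= M -> B <= dot x y.
Proof.
exists (\sum_(i < n) - (`|x 0 i| * M)) => y yM; apply: ler_sum => i _.
apply: (@le_trans _ _ (- `|x 0 i * y 0 i|)); last first.
  by rewrite lerNl -normrN ler_norm.
rewrite lerN2 normrM ler_wpM2l//.
exact: le_trans (coord_le_mx_norm y i) yM.
Qed.

(** Affine minorants of [f] at 0 and of [g] at [p], with an upper bound for [h], suffice on a ball;
    this is what makes the monotone energy converge. *)
Lemma dc_bounded_below f g h p xi (M : R) :
  convex_function [set: 'rV[R]_n] f -> differentiable f 0 ->
  convex_function [set: 'rV[R]_n] h ->
  g p \is a fin_num -> subdifferential g p xi ->
  exists B, forall y, `|y| <= M -> g y \is a fin_num ->
    B <= f y + fine (g y) - h y.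
Proof.
move=> cf df ch /fineK gp sub.
have [B1 hB1] := dot_ge_bounded (gradient f 0) M.
have [B2 hB2] := dot_ge_bounded xi M.
have [B3 hB3] := convex_bounded_above M ch.
exists (f 0 + B1 + (fine (g p) + B2 - dot xi p) - B3) => y yM /fineK gy.
have := sub y; rewrite -gp -gy -EFinD lee_fin dotDr dotNr.
have := convex_gradient_le y cf df; rewrite subr0.
by have := hB1 y yM; have := hB2 y yM; have := hB3 y yM; lra.
Qed.

Lemma cvg_gradient f (L : R) {T} (F : set_system T) {FF : ProperFilter F}
    (u : T -> 'rV[R]_n) x :
  0 < L ->
  (forall u v, enorm (gradient f u - gradient f v) <= L * enorm (u - v)) ->
  u @ F --> x -> (fun k => gradient f (u k)) @ F --> gradient f x.
Proof.
move=> L0 Lf ux.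
have dx : (fun k => u k - x) @ F --> (0 : 'rV[R]_n).
  by rewrite -(subrr x); apply: cvgB => //; exact: cvg_cst.
suff : (fun k => gradient f (u k) - gradient f x) @ F --> (0 : 'rV[R]_n).
  by move/cvg_sub0; apply; exact: cvg_cst.
apply: cvg0_dot.
apply: (@squeeze_cvgr _ _ _ _ (cst 0)
  (fun k => L ^+ 2 * dot (u k - x) (u k - x))).
- apply: nearW => k; rewrite /= dotxx_ge0/=.
  by have := Lf (u k) x; rewrite enorm_leE ?(ltW L0).
- exact: cvg_cst.
- rewrite -[X in _ --> X](mulr0 (L ^+ 2)).
  rewrite -[in X in _ --> X](dot0l (0 : 'rV[R]_n)).
  by apply: cvgM; [exact: cvg_cst|exact: cvg_dot].
Qed.

Lemma fmap_ultra {T U} (u : T -> U) (F : set_system T) :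
  UltraFilter F -> UltraFilter (u @ F).
Proof.
move=> FU; split=> [|G GF FG]; first exact: fmap_proper_filter.
rewrite eqEsubset; split => // A GA.
have [//|FnA] := in_ultra_setVsetC (u @^-1` A) FU.
have GnA : G (~` A) by exact: FG.
by have [y [nAy Ay]] := @filter_ex _ _ GF _ (@filterI _ _ _ _ _ GnA GA).
Qed.

(* An ultrafilter along which the subgradients converge stands for the
   extraction of a further subsequence. *)
Lemma ultra_cvg_bounded {T} (U : set_system T) (u : T -> 'rV[R]_n) (M : R) :
  UltraFilter U -> (\forall k \near U, `|u k| <= M) ->
  exists y, u @ U --> y.
Proof.
move=> UU uM.
have : compact [set x : 'rV[R]_n | `|x| <= M].
  apply: bounded_closed_compact.
    exists M; split; first exact: num_real.
    by move=> N MN x /= /le_trans; apply; exact: ltW.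
  have -> : [set x : 'rV[R]_n | `|x| <= M] =
      (@Num.norm R _) @^-1` [set r | r <= M].
    by [].
  apply: closed_comp; last exact: closed_le.
  by move=> x _; exact: norm_continuous.
rewrite compact_ultra => /(_ (u @ U) (fmap_ultra u UU) uM)[y [_ uy]].
by exists y.
Qed.

Lemma increasing_seq_cvg (s : nat -> nat) : increasing_seq s -> s @ \oo --> \oo.
Proof.
move=> si.
have sn k : (k <= s k)%N.
  elim: k => // k; move=> /leq_ltn_trans; apply.
  have := leW_mono si k k.+1.
  by rewrite /Order.lt/= ltnSn.
move=> A [N _ NA]; exists N => // k /= Nk; apply: NA => /=.
exact: leq_trans Nk (sn k).
Qed.


Lemma limit_point_critical f g h (L lambda M l : R) (x eta xi : nat -> 'rV[R]_n)
    (s : nat -> nat) xhat :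
  (forall u, differentiable f u) -> 0 < L ->
  (forall u v, enorm (gradient f u - gradient f v) <= L * enorm (u - v)) ->
  convex_function [set: 'rV[R]_n] h -> lower_semicontinuous g ->
  (forall k, `|x k.+1| <= M) ->
  (forall k, subdifferential (EFin \o h) (x k) (eta k)) ->
  (forall k, subdifferential g (x k.+1) (xi k)) ->
  (forall k, g (x k.+1) \is a fin_num) ->
  (fun k => residual f lambda (x k) (eta k) (xi k) (x k.+1)) @ \oo
    --> (0 : 'rV[R]_n) ->
  (fun k => x k.+1 - x k) @ \oo --> (0 : 'rV[R]_n) ->
  (fun k => f (x k.+1) + fine (g (x k.+1)) - h (x k.+1)) @ \oo --> l ->
  increasing_seq s -> (x \o s) @ \oo --> xhat ->
  critical_points f g h xhat /\ objective f g h xhat = l%:E.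
Proof.
move=> df L0 Lf ch lscg xM heta hxi gfin res0 dx0 Phil si xs.
(* [U] refines the image of [\oo] under [s] and, since [s] increases, [\oo] itself, so limits of the
   full sequence and the limit [xhat] both hold along it. *)
have [U [UU sU]] := ultraFilterLemma (fmap_proper_filter s eventually_filter).
have Uoo : U `=>` \oo.
  exact: subset_trans (increasing_seq_cvg si) sU.
have xU : x @ U --> xhat.
  by move=> A /xs; exact: sU.
have dU : (fun k => x k.+1 - x k) @ U --> (0 : 'rV[R]_n).
  exact: cvg_trans (cvg_app _ Uoo) dx0.
have pU : (fun k => x k.+1) @ U --> xhat.
  rewrite (_ : (fun k => x k.+1) = (fun k => x k + (x k.+1 - x k))).
    by rewrite -[xhat]addr0; exact: cvgD.
  by apply/funext => k; rewrite addrC subrK.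
have [K hK] := convex_subdifferential_bounded M ch.
have [etahat etaU] : exists y : 'rV[R]_n, eta @ U --> y.
  apply: (@ultra_cvg_bounded _ _ _ K).
  (* The bound [M] covers only [x k.+1], hence the tail starting at 1. *)
  by apply: Uoo; exists 1%N => // -[//|k] _ /=; exact: hK (xM k) (heta k.+1).
have fc : continuous f by move=> u; exact: differentiable_continuous.
have fU := cvg_comp _ _ pU (fc xhat).
have hU := cvg_comp _ _ pU (convex_continuous ch (x := xhat)).
have hU' := cvg_comp _ _ xU (convex_continuous ch (x := xhat)).
have GU : (fun k => gradient f (x k.+1)) @ U --> gradient f xhat.
  exact: cvg_gradient L0 Lf pU.
pose xihat := etahat - gradient f xhat.
have xiU : xi @ U --> xihat.
  rewrite (_ : xi = fun k => residual f lambda (x k) (eta k) (xi k) (x k.+1)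
      + (eta k - gradient f (x k.+1) - lambda *: (x k.+1 - x k))); last first.
    apply/funext => k; apply/rowP => i; rewrite /residual !mxE.
    by move: ('D_ _ f _) => t; ring.
  rewrite -[xihat]add0r; apply: cvgD.
    exact: cvg_trans (cvg_app _ Uoo) res0.
  rewrite -[xihat]subr0; apply: cvgB; first exact: cvgB.
  by rewrite -(scaler0 _ lambda); apply: cvgZl_tmp.
(* The only possible limit of [g (x k.+1)], given the limit [l] of the objective and continuity of
   [f] and [h]. *)
pose gam := l - f xhat + h xhat.
have gU : (fun k => fine (g (x k.+1))) @ U --> gam.
  rewrite (_ : (fun k => _) = fun k =>
    (f (x k.+1) + fine (g (x k.+1)) - h (x k.+1)) - f (x k.+1)
    + h (x k.+1)); last by apply/funext => k; ring.
  apply: cvgD => //; apply: cvgB => //.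
  exact: cvg_trans (cvg_app _ Uoo) Phil.
have gsub z : ((gam + dot xihat (z - xhat))%:E <= g z)%E.
  case E : (g z) => [r| |]; rewrite ?leey//; last first.
    by have := hxi 0%N z; rewrite E -(fineK (gfin 0%N)) -EFinD leeNy_eq.
  rewrite lee_fin.
  apply: (@cvgr_to_le _ U _ _
    (fun k => fine (g (x k.+1)) + dot (xi k) (z - x k.+1))).
    apply: cvgD => //; apply: cvg_dot => //.
    by apply: cvgB => //; exact: cvg_cst.
  apply: nearW => k; have := hxi k z.
  by rewrite E -(fineK (gfin k)) -EFinD lee_fin.
have gxhat : g xhat = gam%:E.
  apply/eqP; rewrite eq_le; apply/andP; split; last first.
    by have := gsub xhat; rewrite subrr dot0r addr0.
  rewrite leNgt; apply/negP => ltg.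
  have [a [ga ag]] : exists a, gam < a /\ (a%:E < g xhat)%E.
    case: (g xhat) ltg => [r||//].
      by rewrite lte_fin => gr; exists ((gam + r) / 2); rewrite lte_fin; lra.
    by move=> _; exists (gam + 1); rewrite ltry; lra.
  have [V xV gV] := lscg _ _ ag.
  suff : a <= gam by lra.
  apply: (@cvgr_to_ge _ U _ _ _ _ _ gU).
  have UV : U [set k | V (x k.+1)] := pU _ xV.
  apply: filterS UV => k /gV.
  by rewrite -(fineK (gfin k)) lte_fin => /ltW.
have hsub z : h xhat + dot etahat (z - xhat) <= h z.
  apply: (@cvgr_to_le _ U _ _ (fun k => h (x k) + dot (eta k) (z - x k))).
    apply: cvgD => //; apply: cvg_dot => //.
    by apply: cvgB => //; exact: cvg_cst.
  by apply: nearW => k; have := heta k z; rewrite /= -EFinD lee_fin.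
split.
  exists xihat, etahat; split.
  - by move=> z; rewrite gxhat -EFinD.
  - by move=> z; rewrite /= -EFinD lee_fin.
  - by rewrite /xihat addrCA subrr addr0 subrr.
by rewrite /objective gxhat -!EFinD /gam; congr EFin; ring.
Qed.

End Limits.

(** * Energy descent, vanishing increments and the common limit *)

Theorem theorem4p1 (R : realType) (n : nat)
  (f : 'rV[R]_n -> R) (g : 'rV[R]_n -> \bar R) (h : 'rV[R]_n -> R)
  (L lambda delta mu tau tol : R)
  (xm1 : 'rV[R]_n) (x : nat -> 'rV[R]_n)
  (f_convex : convex_function [set: 'rV[R]_n] f)
  (f_diff : forall u, differentiable f u)
  (L_gt0 : 0 < L)
  (f_smooth : forall u v,
     enorm (gradient f u - gradient f v) <= L * enorm (u - v))
  (g_proper : proper g) (g_convex : econvex g)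
  (g_lsc : lower_semicontinuous g)
  (h_convex : convex_function [set: 'rV[R]_n] h)
  (F_level_bounded : level_bounded (objective f g h))
  (tol_ge0 : 0 <= tol)
  (lambda_gt0 : 0 < lambda)
  (delta_gt0 : 0 < delta) (delta_lt : delta < 2 * lambda / L)
  (muE : mu = 2 / (2 * lambda + L))
  (tauE : tau = (1 - mu * lambda) ^+ 2 * delta ^+ 2 / (2 * lambda * mu ^+ 2))
  (x_cDCA : cDCA_sequence f g h lambda mu delta tol xm1 x) :
  let F := objective f g h in
  let E := energy f g h tau in
  let xprev := previous xm1 x in
  [/\ tau = L ^+ 2 * delta ^+ 2 / (8 * lambda) /\ tau < lambda / 2,
      nonincreasing_seq (fun k => E (x k) (xprev k)) /\
      (forall k, (E (x k.+1) (x k)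
                  + ((lambda / 2 - tau) * enorm (x k - x k.+1) ^+ 2)%:E
                  <= E (x k) (xprev k))%E),
      subsequential_limits x `<=` critical_points f g h &
      exists l : R,
        [/\ (fun k => F (x k)) @ \oo --> l%:E,
            (fun k => E (x k) (xprev k)) @ \oo --> l%:E &
            forall xhat, subsequential_limits x xhat -> F xhat = l%:E]].

Proof.
have tauE' : tau = L ^+ 2 * delta ^+ 2 / (8 * lambda).
  rewrite tauE (one_sub_step_size_lambda L_gt0 lambda_gt0 muE); field.
  by rewrite !lt0r_neq0// (step_size_gt0 L_gt0 lambda_gt0 muE).
have tau_ge0 : 0 <= tau.
  by rewrite tauE' divr_ge0 ?mulr_ge0 ?sqr_ge0// ltW.
(* This amounts to [(L delta)^2 < (2 lambda)^2]. *)
have tau_lt : tau < lambda / 2.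
  rewrite tauE' ltr_pdivrMr ?mulr_gt0//.
  have Ld : L * delta < 2 * lambda by rewrite mulrC -ltr_pdivlMr.
  have Ld0 : 0 < L * delta by rewrite mulr_gt0.
  rewrite -exprMn.
  by nra.
have [_ x_step] := x_cDCA.
have /choice[eta /choice[xi step]] := fun k => cDCA_step_residual f_convex
  f_diff L_gt0 f_smooth g_proper g_convex lambda_gt0 delta_gt0 muE (x_step k).
have gfin k : g (x k.+1) \is a fin_num by have [] := step k.
have heta k : subdifferential (EFin \o h) (x k) (eta k) by have [] := step k.
have hxi k : subdifferential g (x k.+1) (xi k) by have [] := step k.
pose r k := residual f lambda (x k) (eta k) (xi k) (x k.+1).
have r_le k : dot (r k) (r k) <= 2 * lambda *
    (tau * dot (x k - previous xm1 x k) (x k - previous xm1 x k)).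
  have [_ _ _] := step k; congr (_ <= _); rewrite tauE'; field.
  exact: lt0r_neq0.
have decr k : g (x k) \is a fin_num ->
    f (x k.+1) + fine (g (x k.+1)) - h (x k.+1)
      + lambda / 2 * dot (x k - x k.+1) (x k - x k.+1) <=
    f (x k) + fine (g (x k)) - h (x k)
      + tau * dot (x k - previous xm1 x k) (x k - previous xm1 x k).
  by move=> gk; exact: (step_decrease f_convex f_diff lambda_gt0 gk (gfin k)
    (heta k) (hxi k) (r_le k)).
have objE y : g y \is a fin_num ->
    objective f g h y = (f y + fine (g y) - h y)%:E.
  by rewrite /objective; case: (g y).
have Edecr k : (energy f g h tau (x k.+1) (x k)
    + ((lambda / 2 - tau) * enorm (x k - x k.+1) ^+ 2)%:E
    <= energy f g h tau (x k) (previous xm1 x k))%E.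
  have [gk|gk] := boolP (g (x k) \is a fin_num).
    rewrite /energy !objE// -!EFinD lee_fin !enormE (dotBC (x k.+1)).
    by have := decr k gk; lra.
  (* Only the arbitrary starting point [x 0] can lie outside the domain of [g]; the right-hand side
     is then [+oo]. *)
  have gxk : g (x k) = +oo%E.
    by move: gk; rewrite fin_numE g_proper.1/= negbK => /eqP.
  by rewrite /energy {2}/objective gxk /= leey.
(* Real-valued objective, squared increment and energy, all shifted by one index because the
   objective at [x 0] may be infinite. *)
pose Phi k := f (x k.+1) + fine (g (x k.+1)) - h (x k.+1).
pose D k := dot (x k.+1 - x k) (x k.+1 - x k).
pose V k := Phi k + tau * D k.
have D_ge0 k : 0 <= D k := dotxx_ge0 _.
have Vdecr k : V k.+1 + (lambda / 2 - tau) * D k.+1 <= V k.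
  have := decr k.+1 (gfin k).
  by rewrite dotBC -/(Phi k.+1) -/(Phi k) -/(D k.+1) -/(D k) /V; lra.
have Vmono : nonincreasing_seq V.
  apply/nonincreasing_seqP => k; apply: le_trans (Vdecr k).
  by rewrite lerDl mulr_ge0//; lra.
have PhiV k : Phi k <= V k by rewrite lerDl mulr_ge0.
have [M xM] : exists M, forall k, `|x k.+1| <= M.
  (* Every [x k.+1] lies in the level set of the first finite energy value [V 0]. A [bounded_set]
     witness gives bounds only strictly above it, hence [N + 1]. *)
  have [N [_ HN]] := F_level_bounded (V 0%N).
  exists (N + 1) => k; apply: (HN (N + 1)); first by rewrite ltrDl.
  by rewrite /= objE// lee_fin (le_trans (PhiV k))// Vmono.
have [B hB] := dc_bounded_below M f_convex (f_diff 0) h_convex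
  (gfin 0%N) (hxi 0%N).
have [l Vl] : exists l : R, V @ \oo --> l.
  apply/(cvg_ex (V @ \oo)); apply: nonincreasing_is_cvgn => //.
  exists B => _ [k _ <-].
  by apply: le_trans (PhiV k); exact: hB.
have D0 : D @ \oo --> (0 : R).
  rewrite -cvg_shiftS.
  (* Each squared increment is at most a constant times one decrement of the convergent sequence
     [V], so no summation is involved. *)
  apply: (@squeeze_cvgr _ _ _ _ (cst 0)
    (fun k => (lambda / 2 - tau)^-1 * (V k - V k.+1))).
  - apply: nearW => k; rewrite /= D_ge0/= ler_pdivlMl; last by lra.
    by have := Vdecr k; lra.
  - exact: cvg_cst.
  - rewrite -[X in _ --> X](mulr0 (lambda / 2 - tau)^-1).
    rewrite -[in X in _ --> X](subrr l).
    apply: cvgM; first exact: cvg_cst.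
    by apply: cvgB => //; move: Vl; rewrite -cvg_shiftS.
have Phil : Phi @ \oo --> l.
  rewrite (_ : Phi = fun k => V k - tau * D k); last first.
    by apply/funext => k; rewrite /V addrK.
  rewrite -[X in _ --> X](subr0 l) -[in X in _ --> X](mulr0 tau).
  by apply: cvgB => //; apply: cvgM => //; exact: cvg_cst.
have dx0 : (fun k => x k.+1 - x k) @ \oo --> (0 : 'rV[R]_n) by exact: cvg0_dot.
have r0 : r @ \oo --> (0 : 'rV[R]_n).
  rewrite -cvg_shiftS; apply: cvg0_dot.
  apply: (@squeeze_cvgr _ _ _ _ (cst 0) (fun k => 2 * lambda * tau * D k)).
  - apply: nearW => k; rewrite dotxx_ge0/= -mulrA; exact: (r_le k.+1).
  - exact: cvg_cst.
  - rewrite -[X in _ --> X](mulr0 (2 * lambda * tau)).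
    by apply: cvgM => //; exact: cvg_cst.
have limit_point xhat : subsequential_limits x xhat ->
    critical_points f g h xhat /\ objective f g h xhat = l%:E.
  move=> [s si xs].
  exact: (limit_point_critical f_diff L_gt0 f_smooth h_convex g_lsc xM heta hxi
    gfin r0 dx0 Phil si xs).
move=> F E xprev; split => //.
- split => //; apply/nonincreasing_seqP => k.
  apply: le_trans (Edecr k); rewrite leeDl// lee_fin mulr_ge0 ?sqr_ge0//.
  by lra.
- by move=> xhat /limit_point[].
- exists l; split; last by move=> xhat /limit_point[].
  + rewrite -cvg_shiftS (_ : [sequence F (x k.+1)]_k = EFin \o Phi).
      by apply: cvg_EFin => //; exact: nearW.
    by apply/funext => k; rewrite /F/= objE.
  + rewrite -cvg_shiftS (_ : [sequence E (x k.+1) (xprev k.+1)]_k = EFin \o V).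
      by apply: cvg_EFin => //; exact: nearW.
    by apply/funext => k; rewrite /E/= /energy objE// enormE -EFinD.
Qed.
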